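(* Let $V$ be a finite set and $f \colon 2^V \to \mathbb{R}$ a submodular function. For any $S \subseteq V$, the function $f \circ \sigma_S$ (i.e. $X \mapsto f(X \vartriangle S)$) is submodular if and only if $M_f \boldsymbol{\chi}_S \equiv \mathbf{0} \pmod 2$.
   Context: For $f\colon 2^V \to \mathbb{R}$ and $X,Y \subseteq V$, $\Phi_f(X,Y) = f(X)+f(Y)-f(X\cup Y)-f(X \cap Y)$; $f$ is submodular if $\Phi_f(X,Y) \ge 0$ for all $X,Y \subseteq V$ (no normalization $f(\emptyset)=0$ assumed). $X \vartriangle S$ is the symmetric difference. $\mathcal{P} = \{ (X,\{u,v\}) : X \subseteq V,\ u,v \in V \setminus X,\ u \ne v\}$, and for $(X,\{u,v\}) \in \mathcal{P}$, $\check{\Phi}_f(X,\{u,v\}) = f(X \cup \{u\}) + f(X \cup \{v\}) - f(X \cup \{u,v\}) - f(X)$. $M_f$ is the $0$-$1$ matrix with rows indexed by $\mathcal{P}$ and columns by $V$ whose $(X,\{u,v\})$-row is the characteristic (row) vector of $\{u,v\}$ if $\check{\Phi}_f(X,\{u,v\}) \ne 0$ and the zero vector otherwise. $\boldsymbol{\chi}_S \in \{0,1\}^V$ is the characteristic vector of $S$. *)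

(* Defs.v *)
From HB Require Import structures.
From mathcomp Require Import all_boot all_order all_algebra.
From mathcomp Require Import reals.

Set Implicit Arguments.
Unset Strict Implicit.
Unset Printing Implicit Defensive.

Import Order.TTheory GRing.Theory Num.Theory.
Local Open Scope ring_scope.

Section Submodular.
Variables (R : realType) (V : finType).
Implicit Types (f : {set V} -> R) (X Y S e : {set V}) (u v : V).

Definition Phi f X Y : R := f X + f Y - f (X :|: Y) - f (X :&: Y).

Definition submodular f : Prop := forall X Y, 0 <= Phi f X Y.

Definition symdiff X S : {set V} := (X :\: S) :|: (S :\: X).

Definition pairs : {set {set V} * {set V}} :=
  [set p : {set V} * {set V} | [exists u : V, exists v : V,
     [&& u != v, u \notin p.1, v \notin p.1 & p.2 == [set u; v]]]].

(* The unordered pair {u, v} is given as the two-element set e, so that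
   f (X U {u}) + f (X U {v}) is written as a sum over e, independently of the
   order of u and v; see local_PhiE. *)
Definition local_Phi f X e : R :=
  \sum_(u in e) f (u |: X) - f (X :|: e) - f X.

Lemma local_PhiE f X u v : u != v ->
  local_Phi f X [set u; v] = f (u |: X) + f (v |: X) - f (X :|: [set u; v]) - f X.
Proof. by move=> uv; rewrite /local_Phi big_setU1 ?inE //= big_set1. Qed.

(* MathComp matrices are indexed by ordinals: row i stands for the i-th element
   of pairs and column j for the j-th element of V, via enum_val. *)
Definition char_vec S : 'cV[int]_#|V| := \col_j ((enum_val j \in S) : nat)%:Z.

Definition switch_mx f : 'M[int]_(#|pairs|, #|V|) :=
  \matrix_(i, j)
    let: (X, e) := enum_val i in
    if local_Phi f X e != 0 then (char_vec e)^T 0 j else 0.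

End Submodular.

(* Main.v *)
(** Submodularity need only be tested on the pairs [(X + u, X + v)]. On such a
    pair, switching by [S] replaces the local defect of [f] at [X] by the one at
    [(X symdiff S) - {u, v}], with the opposite sign exactly when [S] separates
    [u] from [v]. As all local defects of [f] are nonnegative, the switched
    function is submodular iff the defects at separated pairs vanish, and the
    row of the matrix at [(X, {u, v})] expresses precisely this. *)
Require Import Defs.
From HB Require Import structures.
From mathcomp Require Import all_boot all_order all_algebra.
From mathcomp Require Import reals.
From mathcomp Require Import lra.

Set Implicit Arguments.
Unset Strict Implicit.
Unset Printing Implicit Defensive.

Import Order.TTheory GRing.Theory Num.Theory.
Local Open Scope ring_scope.

Section LocalDefect.
Variables (R : realType) (V : finType).
Implicit Types (f g : {set V} -> R) (A B D S X Y Z e : {set V}) (u v : V).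

(** Taking [u] and [v] as separate arguments lets the sign under switching be read off from
    [u \in S] and [v \in S]. *)
Definition defect f X u v : R :=
  f (u |: X) + f (v |: X) - f (u |: (v |: X)) - f X.

Lemma local_Phi_defect f X u v :
  u != v -> local_Phi f X [set u; v] = defect f X u v.
Proof. by move=> uv; rewrite local_PhiE // (setUC X) -setUA. Qed.

Lemma submodular_defect f X u v : submodular f ->
  u != v -> u \notin X -> v \notin X -> 0 <= defect f X u v.
Proof.
move=> sf uv uX vX; have := sf (u |: X) (v |: X).
rewrite /Phi -setUA (setUCA X) setUid.
have -> // : (u |: X) :&: (v |: X) = X.
apply/setP => w; rewrite !inE.
by case: eqVneq => [->|_]; rewrite ?(negPf uv) ?(negPf uX) //= orKb.
Qed.

Section LocalToGlobal.
Variable g : {set V} -> R.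
Hypothesis g_defect : forall X u v,
  u != v -> u \notin X -> v \notin X -> 0 <= defect g X u v.

(** Induction on the size of [B :\: A]: for [v] in that difference, the defect at [B :\ v] compares
    the marginals of [u] at [B] and at [B :\ v]. *)
Lemma marginal_antitone A B u : A \subset B -> u \notin B ->
  g (u |: B) - g B <= g (u |: A) - g A.
Proof.
have [n] := ubnP #|B :\: A|.
elim: n B => // n IHn B ltn sAB uB.
have [/eqP|[v]] := set_0Vmem (B :\: A).
  by rewrite setD_eq0 => sBA; have -> : B = A by apply/eqP; rewrite eqEsubset sBA.
rewrite !inE => /andP[vA vB].
have uv : u != v by apply: contraNneq uB => ->.
have uB' : u \notin B :\ v by rewrite !inE (negPf uB) andbF.
have := IHn (B :\ v) _ _ uB'.
have -> : (#|(B :\ v) :\: A| < n)%N.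
  rewrite -ltnS; apply: leq_trans ltn; rewrite ltnS.
  apply: proper_card; rewrite setDDl setUC -setDDl.
  by apply: properD1; rewrite !inE vA.
rewrite subsetD1 sAB vA => /(_ isT isT).
have := g_defect uv uB' (negbT (setD11 v B)).
by rewrite /defect (setD1K vB) => d0 d1; lra.
Qed.

(** Adding [D] one element at a time telescopes both increments into marginals, compared by
    [marginal_antitone]. *)
Lemma increment_antitone A B D : A \subset B -> [disjoint B & D] ->
  g (B :|: D) - g B <= g (A :|: D) - g A.
Proof.
have [n] := ubnP #|D|; elim: n D => // n IHn D ltn sAB dBD.
have [->|[v vD]] := set_0Vmem D; first by rewrite !setU0 !subrr.
have vB : v \notin B by rewrite (disjointFl dBD vD).
have := IHn (D :\ v) _ sAB (disjointWr (subD1set _ _) dBD).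
rewrite -ltnS (leq_trans _ ltn) ?ltnS ?proper_card ?properD1 // => /(_ isT).
have := @marginal_antitone (A :|: (D :\ v)) (B :|: (D :\ v)) v
  (setSU _ sAB).
rewrite !inE eqxx (negPf vB) => /(_ isT).
by rewrite !(setUCA [set v]) (setD1K vD) => h1 h2; lra.
Qed.

Lemma defect_submodular : submodular g.
Proof.
move=> X Y; rewrite /Phi.
have dXY : [disjoint X & Y :\: X].
  by rewrite disjoint_sym disjoints_subset setDE subsetIr.
(* Adding [Y :\: X] turns [X :&: Y] into [Y] and [X] into [X :|: Y]. *)
have := increment_antitone (subsetIl X Y) dXY.
rewrite {1}setDE setUIr setUCr setIT (setIC X) setID => h; lra.
Qed.

End LocalToGlobal.

Lemma defect_symdiff f S X u v : u != v -> u \notin X -> v \notin X ->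
  defect (fun X => f (symdiff X S)) X u v =
  (-1) ^+ ((u \in S) (+) (v \in S)) * defect f (symdiff X S :\ u :\ v) u v.
Proof.
move=> uv uX vX; set Z := _ :\ v.
(* [W a b] agrees with [Z] off [u] and [v], while [a] and [b] decide the membership of [u] and [v].
   Both defects are alternating sums over the same four sets [W a b]; switching negates [a] when
   [u \in S] and [b] when [v \in S]. *)
pose W (a b : bool) :=
  [set w | if w == u then a else if w == v then b else w \in Z].
have WZ : [/\ Z = W false false, u |: Z = W true false,
  v |: Z = W false true & u |: (v |: Z) = W true true].
  split; apply/setP => w; rewrite !inE;
  have [->|_] := eqVneq w u; rewrite ?eqxx ?(negPf uv) ?andbF //=;
  by case: eqVneq.
have WX : [/\ symdiff X S = W (u \in S) (v \in S),
   symdiff (u |: X) S = W (u \notin S) (v \in S),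
   symdiff (v |: X) S = W (u \in S) (v \notin S)
 & symdiff (u |: (v |: X)) S = W (u \notin S) (v \notin S)].
  split; apply/setP => w; rewrite !inE;
  have [->|_] := eqVneq w u; rewrite ?eqxx ?(negPf uX) ?(negPf uv) /= ?andbF ?andbT ?orbF //;
  by have [->|_] := eqVneq w v; rewrite ?eqxx ?(negPf vX) /= ?andbF ?andbT ?orbF.
rewrite /defect.
case: WZ => Z0 -> -> ->; rewrite Z0; case: WX => -> -> -> ->.
by case: (u \in S) (v \in S) => [] [] /=; rewrite ?expr0 ?expr1; lra.
Qed.

Lemma symdiffK S X : symdiff (symdiff X S) S = X.
Proof. by apply/setP => w; rewrite !inE; case: (w \in X); case: (w \in S). Qed.

Lemma switch_submodularP f S : submodular f ->
  submodular (fun X => f (symdiff X S)) <->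
  (forall X u v, u != v -> u \notin X -> v \notin X ->
     (u \in S) (+) (v \in S) -> defect f X u v = 0).
Proof.
move=> sf; split => [sg Z u v uv uZ vZ odd_uv | f0].
  (* Chosen so that switching [X] by [S] and removing [u] and [v] gives back [Z]. *)
  set X := symdiff Z S :\ u :\ v.
  have uX : u \notin X by rewrite !inE eqxx andbF.
  have vX : v \notin X by rewrite !inE eqxx.
  have := submodular_defect sg uv uX vX; rewrite defect_symdiff // odd_uv expr1.
  have -> : symdiff X S :\ u :\ v = Z.
    rewrite -[RHS](symdiffK S); apply/setP => w; rewrite !inE.
    have [->|wv] := eqVneq w v; first by rewrite (negPf vZ); case: (v \in S).
    have [->|wu] //= := eqVneq w u; by rewrite (negPf uZ); case: (u \in S).
  (* Both the defect of [f] at [Z] and its negative are nonnegative. *)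
  by have := submodular_defect sf uv uZ vZ; lra.
apply: defect_submodular => X u v uv uX vX; rewrite defect_symdiff //.
have uZ : u \notin symdiff X S :\ u :\ v by rewrite !inE eqxx andbF.
have vZ : v \notin symdiff X S :\ u :\ v by rewrite !inE eqxx.
case: (boolP (_ (+) _)) => [odd_uv | _]; first by rewrite f0 ?mulr0.
by rewrite mul1r submodular_defect.
Qed.

(** A nonzero row is the indicator of its pair [e], so its product with [char_vec S] counts the
    elements of [e] in [S]. *)
Lemma switch_mx_char_vec f S (i : 'I_#|pairs V|) :
  (switch_mx f *m char_vec S) i 0 =
  if local_Phi f (enum_val i).1 (enum_val i).2 != 0
  then \sum_(x in (enum_val i).2) ((x \in S) : nat)%:Z else 0.
Proof.
rewrite mxE; under eq_bigr => j _ do rewrite !mxE.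
case: (enum_val i) => X e /=; case: ifP => _; last first.
  by rewrite big1 // => j _; rewrite mul0r.
under eq_bigr => j _ do rewrite !mxE.
rewrite -(@big_enum_val _ _ _ _ V (fun x => ((x \in e) : nat)%:Z * ((x \in S) : nat)%:Z)).
rewrite [RHS]big_mkcond /=; apply: eq_bigr => x _.
by case: (x \in e); rewrite ?mul1r ?mul0r.
Qed.

(** The number of elements of [S] among [u] and [v] is odd exactly when [S] separates them. *)
Lemma switch_mx_mod2P f S :
  (forall i : 'I_#|pairs V|,
     ((switch_mx f *m char_vec S) i 0%R = 0 %[mod 2])%Z) <->
  (forall X u v, u != v -> u \notin X -> v \notin X ->
     (u \in S) (+) (v \in S) -> defect f X u v = 0).
Proof.
split=> [M0 X u v uv uX vX odd_uv | f0 i].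
  have pXuv : (X, [set u; v]) \in pairs V.
    by rewrite inE; apply/existsP; exists u; apply/existsP; exists v; apply/and4P.
  have := M0 (enum_rank_in pXuv (X, [set u; v])).
  rewrite switch_mx_char_vec enum_rankK_in //= local_Phi_defect //.
  case: eqP => //= _.
  rewrite big_setU1 ?inE //= big_set1.
  by case: (u \in S) (v \in S) odd_uv => [] [].
rewrite switch_mx_char_vec; have := enum_valP i.
case: (enum_val i) => X e; rewrite inE /=.
case/existsP => u /existsP[v /and4P[uv uX vX /eqP->]].
rewrite local_Phi_defect // big_setU1 ?inE //= big_set1.
(* Unseparated pairs contribute 0 or 2, even in either branch of the [if]; for separated pairs the
   defect vanishes, hence so does the row. *)
have := f0 X u v uv uX vX; case: (u \in S) (v \in S) => [] [] /=; try by case: ifP.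
all: by move=> ->; rewrite ?eqxx.
Qed.

End LocalDefect.

Theorem theorem3p3 (R : realType) (V : finType) (f : {set V} -> R)
    (hf : submodular f) (S : {set V}) :
  submodular (fun X => f (symdiff X S)) <->
  (forall i : 'I_#|pairs V|,
     ((switch_mx f *m char_vec S) i 0%R = 0 %[mod 2])%Z).
Proof.
exact: (iff_trans (switch_submodularP S hf) (iff_sym (switch_mx_mod2P f S))).
Qed.
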